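(* Let $\Delta x>0$ be fixed. Then the nonlocal semi-discrete scheme $$\frac{d u_j}{dt}+\frac{g(u_j^+,u_{j+1}^-)-g(u_{j-1}^+,u_j^-)}{\Delta x}W_0+\sum_{k=1}^{r+1}\frac{g(u_j,u_{j+k})-g(u_{j-k},u_j)}{k\Delta x}W_k=0,\qquad j\in\mathbb{Z},$$ (with $r$ and $W_k$ depending on $\delta$ as in the context) converges, as $\delta\to0$, to the local semi-discrete scheme $$\frac{d u_j}{dt}+\frac{g(u_j^+,u_{j+1}^-)-g(u_{j-1}^+,u_j^-)}{\Delta x}=0,\qquad j\in\mathbb{Z},$$ in the sense that for every grid function $(u_j)_{j\in\mathbb{Z}}$ with slopes $(\sigma_j)_{j\in\mathbb{Z}}$ and every $j\in\mathbb{Z}$, $$\frac{g(u_j^+,u_{j+1}^-)-g(u_{j-1}^+,u_j^-)}{\Delta x}W_0+\sum_{k=1}^{r+1}\frac{g(u_j,u_{j+k})-g(u_{j-k},u_j)}{k\Delta x}W_k\;\longrightarrow\;\frac{g(u_j^+,u_{j+1}^-)-g(u_{j-1}^+,u_j^-)}{\Delta x}\qquad(\delta\to0).$$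
   Context: For each $\delta>0$ the kernel $\omega_\delta:\mathbb{R}\to\mathbb{R}$ is integrable with $\omega_\delta\ge 0$, $\operatorname{supp}\omega_\delta\subseteq[0,\delta]$ and $\int_0^\delta\omega_\delta(h)\,dh=1$. Flux: $g:\mathbb{R}\times\mathbb{R}\to\mathbb{R}$ (independent of $\delta$) is consistent with a flux $f$, i.e. $g(u,u)=f(u)$; monotone, i.e. $\partial_1 g\ge 0$, $\partial_2 g\le 0$; and Lipschitz continuous, $|g(u_1,v_1)-g(u_2,v_2)|\le C(|u_1-u_2|+|v_1-v_2|)$. Weights: $r=\lfloor\delta/\Delta x\rfloor$, $\mathcal{I}_k=((k-1)\Delta x,k\Delta x)$, $\Phi_i(h)=\max(0,1-|h-i\Delta x|/\Delta x)$ (piecewise linear hat functions), $W_0=\int_{\mathcal{I}_1}\Phi_0(h)\omega_\delta(h)\,dh$, and $W_k=\int_{\mathcal{I}_k\cup\mathcal{I}_{k+1}}\Phi_k(h)\omega_\delta(h)\,dh$ for $k=1,\dots,r+1$. Reconstruction: given a grid function $(u_j)_{j\in\mathbb{Z}}$, the real numbers $\sigma_j$ are approximate slopes (independent of $\delta$) and $u_j^\pm=u_j\pm\frac12\sigma_j$; they satisfy $-2\le\frac{\sigma_{j+1}-\sigma_j}{u_{j+1}-u_j}\le2$ for all $j$ (understood as $|\sigma_{j+1}-\sigma_j|\le2|u_{j+1}-u_j|$). *)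

(* Defs.v *)
From HB Require Import structures.
From mathcomp Require Import all_boot all_order all_algebra.
From mathcomp Require Import all_classical all_reals all_analysis.

Set Implicit Arguments.
Unset Strict Implicit.
Unset Printing Implicit Defensive.

Import Order.TTheory GRing.Theory Num.Theory.
Import numFieldNormedType.Exports.

Local Open Scope classical_set_scope.
Local Open Scope ring_scope.

Record nonlocal_kernel (R : realType) (delta : R) (w : R -> R) : Prop :=
  NonlocalKernel {
    kernel_integrable :
      (@lebesgue_measure R).-integrable setT (fun h => (w h)%:E);
    kernel_ge0 : forall h, 0 <= w h;
    kernel_supp : closure [set h | w h != 0] `<=` `[0, delta];
    kernel_mass : \int[@lebesgue_measure R]_(h in `[0, delta]) w h = 1 }.

(* A Lipschitz flux has partial derivatives almost everywhere only, so the
   sign conditions are required at the points where these derivatives exist;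
   under [flux_lipschitz] they amount to [g] being nondecreasing in its first
   argument and nonincreasing in its second. *)
Record monotone_flux (R : realType) (f : R -> R) (g : R -> R -> R) : Prop :=
  MonotoneFlux {
    flux_consistent : forall a, g a a = f a;
    flux_partial1_ge0 : forall a b,
      derivable (fun x => g x b) a 1 -> 0 <= derive1 (fun x => g x b) a;
    flux_partial2_le0 : forall a b,
      derivable (fun y => g a y) b 1 -> derive1 (fun y => g a y) b <= 0;
    flux_lipschitz : exists C : R, forall a1 b1 a2 b2,
      `|g a1 b1 - g a2 b2| <= C * (`|a1 - a2| + `|b1 - b2|) }.

Definition cell (R : realType) (dx : R) (k : nat) : set R :=
  `](k%:R - 1) * dx, k%:R * dx[.

Definition hat (R : realType) (dx : R) (i : nat) (h : R) : R :=
  Num.max 0 (1 - `|h - i%:R * dx| / dx).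

Definition weight (R : realType) (dx : R) (w : R -> R) (k : nat) : R :=
  if k == 0%N then \int[@lebesgue_measure R]_(h in cell dx 1) (hat dx 0 h * w h)
  else \int[@lebesgue_measure R]_(h in cell dx k `|` cell dx k.+1)
         (hat dx k h * w h).

(* [Num.truncn] is the floor function, with values in [nat], on [0, +oo[. *)
Definition horizon (R : realType) (dx delta : R) : nat :=
  Num.truncn (delta / dx).

Definition admissible_slopes (R : realType) (u sigma : int -> R) : Prop :=
  forall j, `|sigma (j + 1) - sigma j| <= 2 * `|u (j + 1) - u j|.

Definition uplus (R : realType) (u sigma : int -> R) (j : int) : R :=
  u j + 2^-1 * sigma j.

Definition uminus (R : realType) (u sigma : int -> R) (j : int) : R :=
  u j - 2^-1 * sigma j.

(* The local scheme is [du_j/dt + local_term g dx u sigma j = 0]. *)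
Definition local_term (R : realType) (g : R -> R -> R) (dx : R)
    (u sigma : int -> R) (j : int) : R :=
  (g (uplus u sigma j) (uminus u sigma (j + 1))
   - g (uplus u sigma (j - 1)) (uminus u sigma j)) / dx.

(* The nonlocal scheme is
   [du_j/dt + nonlocal_term g dx delta w u sigma j = 0]. *)
Definition nonlocal_term (R : realType) (g : R -> R -> R) (dx delta : R)
    (w : R -> R) (u sigma : int -> R) (j : int) : R :=
  (g (uplus u sigma j) (uminus u sigma (j + 1))
   - g (uplus u sigma (j - 1)) (uminus u sigma j)) / dx * weight dx w 0
  + \sum_(1 <= k < (horizon dx delta).+2)
      (g (u j) (u (j + k%:Z)) - g (u (j - k%:Z)) (u j)) / (k%:R * dx)
      * weight dx w k.

(* Main.v *)
Require Import Defs.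
From mathcomp Require Import all_boot all_order all_algebra.
From mathcomp Require Import all_classical all_reals all_analysis.
From mathcomp Require Import measurable_realfun.
Import Order.TTheory GRing.Theory Num.Theory.
Import numFieldNormedType.Exports.
Local Open Scope classical_set_scope.
Local Open Scope ring_scope.

(** The kernels have unit mass and their supports [0, delta] shrink to the
    origin, so they converge to a Dirac mass at 0: integrating a hat function
    against them must pick its value at 0, which is 1 for the hat centred at 0
    and 0 for the hat centred at dx.

    Quantitatively, hats are Lipschitz with constant 1 / dx, hence within
    delta / dx of their value at 0 on the support of the kernel; since the
    kernel is nonnegative of mass 1 this gives |W_0 - 1| <= delta / dx and
    |W_1| <= delta / dx ([weight0_dist], [weight1_dist]).  Moreover the horizon
    r vanishes as soon as delta < dx, so that the only surviving terms of the
    nonlocal scheme are the one carrying W_0 and the one carrying W_1.  Their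
    other factors do not depend on delta, and the limit follows by linearity. *)

(** A nonnegative density only averages [phi] over the points where it is
    nonzero, so it suffices to control [phi] there. *)
Lemma Rintegral_weighted_dist d (T : measurableType d) (R : realType)
    (mu : {measure set T -> \bar R}) (D : set T) (phi w : T -> R) (c e : R) :
  measurable D ->
  mu.-integrable D (EFin \o w) ->
  mu.-integrable D (EFin \o (fun x => phi x * w x)) ->
  (forall x, D x -> 0 <= w x) ->
  (forall x, D x -> w x != 0 -> `|phi x - c| <= e) ->
  `|\int[mu]_(x in D) (phi x * w x) - c * \int[mu]_(x in D) w x|
    <= e * \int[mu]_(x in D) w x.
Proof.
move=> mD iw ipw w0 phic.
have iZ a : mu.-integrable D (EFin \o (fun x => a * w x)).
  rewrite (_ : EFin \o _ = (fun x => a%:E * (EFin \o w) x)%E); last first.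
    by apply/funext => x /=; rewrite EFinM.
  exact: integrableZl.
have bnd x : D x -> `|phi x * w x - c * w x| <= e * w x.
  move=> Dx; rewrite -mulrBl normrM (ger0_norm (w0 _ Dx)).
  have [->|wx0] := eqVneq (w x) 0; first by rewrite !mulr0.
  by rewrite ler_wpM2r ?w0 ?phic.
have iB : mu.-integrable D (EFin \o (fun x => phi x * w x - c * w x)).
  exact: (integrableB mD ipw (iZ c)).
rewrite -!RintegralZl// -RintegralB//.
apply: (le_trans (le_normr_Rintegral mD iB)).
by apply: le_Rintegral => //; exact: integrable_norm iB.
Qed.

Lemma hat_bounds (R : realType) (dx : R) (i : nat) (h : R) : 0 < dx ->
  0 <= hat dx i h <= 1.
Proof.
move=> dx0; rewrite /hat le_max lexx/= ge_max ler01/= gerBl.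
by rewrite divr_ge0// ltW.
Qed.

Lemma measurable_hat (R : realType) (dx : R) (i : nat) (D : set R) :
  measurable_fun D (hat dx i).
Proof.
apply: measurable_funTS; apply: measurable_maxr => //.
apply: measurable_funB => //; apply: measurable_funM => //.
by apply: measurableT_comp => //; apply: measurable_funB.
Qed.

(** This bound and the next one compare a hat with its value at the origin:
    hats are Lipschitz with constant 1 / dx. *)
Lemma hat0_dist (R : realType) (dx h : R) : 0 < dx ->
  0 <= h -> `|hat dx 0 h - 1| <= h / dx.
Proof.
move=> dx0 h0; have hdx : 0 <= h / dx by rewrite divr_ge0// ltW.
rewrite /hat mul0r subr0 (ger0_norm h0) distrC ger0_norm.
  by rewrite lerBlDr -lerBlDl le_max lexx orbT.
by rewrite subr_ge0 ge_max ler01 gerBl.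
Qed.

Lemma hat1_dist (R : realType) (dx h : R) : 0 < dx ->
  0 <= h -> `|hat dx 1 h - 0| <= h / dx.
Proof.
move=> dx0 h0; have hdx : 0 <= h / dx by rewrite divr_ge0// ltW.
rewrite subr0 ger0_norm; last by have /andP[] := @hat_bounds R dx 1 h dx0.
rewrite /hat mul1r ge_max hdx/= lerBlDr -[leLHS](divff (lt0r_neq0 dx0)).
by rewrite -mulrDl ler_pM2r ?invr_gt0// -lerBlDl distrC ler_norm.
Qed.

Section kernel.
Context {R : realType} (delta : R) (w : R -> R).
Context (delta0 : 0 < delta) (kw : nonlocal_kernel delta w).
Let mu := @lebesgue_measure R.

Lemma kernel_neq0 h : w h != 0 -> 0 <= h <= delta.
Proof.
move=> wh; have /= := kernel_supp kw
  (subset_closure (A := [set x | w x != 0]) wh).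
by rewrite in_itv.
Qed.

Lemma kernel_integrableS (D : set R) : measurable D ->
  mu.-integrable D (EFin \o w).
Proof. by move=> mD; apply: (integrableS _ _ _ (kernel_integrable kw)). Qed.

Lemma hat_kernel_integrable (dx : R) i (D : set R) : 0 < dx -> measurable D ->
  mu.-integrable D (EFin \o (fun h => hat dx i h * w h)).
Proof.
move=> dx0 mD; have iw := kernel_integrableS _ mD.
apply: le_integrable (iw) => //=.
  apply/measurable_EFinP; apply: measurable_funM; first exact: measurable_hat.
  by apply/measurable_EFinP; exact: measurable_int iw.
move=> h _; have /andP[h0 h1] := @hat_bounds R dx i h dx0.
by rewrite lee_fin normrM ler_piMl// ger0_norm.
Qed.

(** The open cells miss the origin, which may belong to the support: the mass
    is not affected because a singleton is Lebesgue-null. *)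
Lemma kernel_massS (D : set R) : D `&` `[0, delta] = `]0, delta]%classic ->
  \int[mu]_(h in D) w h = 1.
Proof.
move=> DE; rewrite -(kernel_mass kw) -Rintegral_itv_obnd_cbnd; last first.
  exact: kernel_integrableS.
rewrite -DE Rintegral_mkcondr; congr Rintegral; apply/funext => h.
rewrite patchE; case: ifPn => // /negP hn.
apply/eqP/negPn/negP => /kernel_neq0 hd; apply: hn.
by rewrite inE/= in_itv.
Qed.

(** The constant [c] stands for the value of the hat at the origin.  Unit mass
    turns the pointwise deviation on the support into the same deviation of the
    integral. *)
Lemma hat_kernel_dist (dx : R) i (D : set R) (c : R) : 0 < dx ->
  measurable D -> D `&` `[0, delta] = `]0, delta]%classic ->
  (forall h, 0 <= h -> `|hat dx i h - c| <= h / dx) ->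
  `|\int[mu]_(h in D) (hat dx i h * w h) - c| <= delta / dx.
Proof.
move=> dx0 mD DE hc; rewrite -[c]mulr1 -[leRHS]mulr1 -(kernel_massS _ DE).
apply: Rintegral_weighted_dist => //.
- exact: kernel_integrableS.
- exact: hat_kernel_integrable.
- by move=> h _; exact: kernel_ge0 kw h.
- move=> h _ /kernel_neq0/andP[h0 hd].
  by rewrite (le_trans (hc _ h0))// ler_pM2r ?invr_gt0.
Qed.

Lemma weight0_dist (dx : R) : delta < dx -> `|weight dx w 0 - 1| <= delta / dx.
Proof.
move=> ddx; have dx0 := lt_trans delta0 ddx.
apply: hat_kernel_dist => // [||h]; [exact: measurable_itv| |exact: hat0_dist].
apply/seteqP; split=> h /=; rewrite /cell/= !in_itv/= subrr mul0r mul1r.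
  by move=> [/andP[-> _] /andP[_ ->]].
by move=> /andP[h0 hd]; rewrite h0 hd ltW// (le_lt_trans hd).
Qed.

(** The set defining W_1 is a union of two cells and misses their common
    endpoint dx; the assumption [delta < dx] keeps the support away from it. *)
Lemma weight1_dist (dx : R) : delta < dx -> `|weight dx w 1| <= delta / dx.
Proof.
move=> ddx; have dx0 := lt_trans delta0 ddx; rewrite -[weight _ _ _]subr0.
apply: hat_kernel_dist => // [||h]; last exact: hat1_dist.
  by apply: measurableU; exact: measurable_itv.
apply/seteqP; split=> h /=; rewrite /cell/= !in_itv/= subrr mul0r mul1r.
  move=> [[/andP[-> _]|/andP[h1 _]] /andP[_ ->]] //.
  rewrite andbT (lt_trans _ h1)//; apply: (lt_le_trans dx0).
  by rewrite -[2]/(1 + 1) addrK mul1r.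
move=> /andP[h0 hd]; rewrite h0 hd ltW// (le_lt_trans hd)//.
by split; first left.
Qed.

End kernel.

Lemma cvg_at_right0_dist (R : realType) (dx c : R) (F : R -> R) : 0 < dx ->
  (forall delta, 0 < delta -> delta < dx -> `|F delta - c| <= delta / dx) ->
  F delta @[delta --> 0^'+] --> c.
Proof.
move=> dx0 Fc; apply/cvgrPdist_le => e e0; near=> delta.
rewrite distrC; apply: le_trans (Fc _ _ _) _.
- by near: delta; exact: nbhs_right_gt.
- by near: delta; exact: nbhs_right_lt.
- by rewrite ler_pdivrMr//; near: delta; apply: nbhs_right_le; exact: mulr_gt0.
Unshelve. all: by end_near. Qed.

Lemma horizon_eq0 (R : realType) (dx delta : R) : 0 < delta -> delta < dx ->
  horizon dx delta = 0%N.
Proof.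
move=> d0 ddx; have dx0 := lt_trans d0 ddx.
apply: truncn_def; rewrite divr_ge0 ?ltW//=.
by rewrite ltr_pdivrMr// mul1r.
Qed.

Theorem proposition3p1 (R : realType) (omega : R -> R -> R)
    (f : R -> R) (g : R -> R -> R) (dx : R)
    (homega : forall delta : R, 0 < delta ->
       nonlocal_kernel delta (omega delta))
    (hg : monotone_flux f g) (hdx : 0 < dx) :
  forall u sigma : int -> R, admissible_slopes u sigma ->
  forall j : int,
    nonlocal_term g dx delta (omega delta) u sigma j @[delta --> 0^'+]
      --> local_term g dx u sigma j.
Proof.
move=> u sigma _ j.
pose B := (g (u j) (u (j + 1%:Z)) - g (u (j - 1%:Z)) (u j)) / (1%:R * dx).
have W0 : weight dx (omega delta) 0 @[delta --> 0^'+] --> (1 : R).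
  pose W delta := weight dx (omega delta) 0.
  apply: (@cvg_at_right0_dist _ dx 1 W) => // delta d0 ddx.
  exact: weight0_dist (homega _ d0) _ ddx.
have W1 : weight dx (omega delta) 1 @[delta --> 0^'+] --> (0 : R).
  pose W delta := weight dx (omega delta) 1.
  apply: (@cvg_at_right0_dist _ dx 0 W) => // delta d0 ddx.
  by rewrite subr0; exact: weight1_dist (homega _ d0) _ ddx.
(* The expression of the nonlocal term for delta < dx, where r = 0. *)
have lim : local_term g dx u sigma j * weight dx (omega delta) 0
    + B * weight dx (omega delta) 1 @[delta --> 0^'+]
    --> local_term g dx u sigma j.
  rewrite -[X in _ --> X]addr0 -[X in X + _]mulr1 -[X in _ + X](mulr0 B).
  by apply: cvgD; apply: cvgM => //; exact: cvg_cst.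
apply: cvg_trans lim; apply: near_eq_cvg; near=> delta.
rewrite /nonlocal_term horizon_eq0; last 2 first.
- by near: delta; exact: nbhs_right_gt.
- by near: delta; exact: nbhs_right_lt.
by rewrite big_nat1.
Unshelve. all: by end_near. Qed.
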